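(* Let $(V,g)$ be a Euclidean real vector space of dimension $n$ and let $h=h(t)$ be a (differentiable) one-parameter family of bilinear forms on $V$. Then for every $1\le k\le n$, $$\frac{d}{dt}s_k(h)=\Bigl\langle t_{k-1}(h),\frac{dh}{dt}\Bigr\rangle,$$ where $s_k(h)$ are the characteristic coefficients of $h$ and $t_{k}(h)=\frac{1}{k!\,(n-1-k)!}*\bigl(g^{n-1-k}h^k\bigr)$ for $0\le k\le n-1$. In particular, for $k=n$, $$\frac{d}{dt}\det(h)=\Bigl\langle t_{n-1}(h),\frac{dh}{dt}\Bigr\rangle.$$
   Context: Let $(V,g)$ be a Euclidean real vector space of dimension $n$. A $(p,q)$ double form is an element of $\mathcal D^{p,q}=\Lambda^pV^*\otimes\Lambda^qV^*$, identified with a bilinear form $\Lambda^pV\times\Lambda^qV\to\mathbb R$. Exterior product: $(\theta_1\otimes\theta_2)(\theta_3\otimes\theta_4)=(\theta_1\wedge\theta_3)\otimes(\theta_2\wedge\theta_4)$, extended bilinearly; products and powers in the claim are exterior products, with zeroth power $1$; bilinear forms such as $g,h$ are regarded as $(1,1)$ double forms. Double Hodge star: for a $(p,p)$ double form $\omega$, $*\omega$ is the $(n-p,n-p)$ double form $*\omega(u,v)=\omega( *u,*v)$, with $*$ on the right the usual Hodge star $\Lambda^{n-p}V\to\Lambda^{p}V$ for some chosen orientation (the result does not depend on it). The inner product of bilinear forms is $\langle a,b\rangle=\sum_{i,j}a(e_i,e_j)b(e_i,e_j)$ for any orthonormal basis $(e_i)$. The invariants $s_k(h)$, $0\le k\le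 n$, are defined by $\det(\bar h-\lambda I)=\sum_{k=0}^n(-1)^{n-k}s_k(h)\lambda^{n-k}$, where $\bar h$ is the linear operator on $V$ corresponding to $h$ via $g$ (with matrix $(h(e_i,e_j))$, up to transposition, in an orthonormal basis); $\det h=s_n(h)$ is the determinant of $\bar h$. The inner product $g$ is fixed, independent of $t$. *)

(* Defs.v *)
From HB Require Import structures.
From mathcomp Require Import all_boot all_order all_algebra all_fingroup.
From mathcomp Require Import boolp.

Set Implicit Arguments.
Unset Strict Implicit.
Unset Printing Implicit Defensive.
Import GRing.Theory Num.Theory.
Local Open Scope ring_scope.

Section DoubleForms.
Variables (R : realFieldType) (V : lmodType R).

Definition multilinear p (f : ('I_p -> V) -> R) : Prop :=
  forall x i, scalar (fun u => f [eta x with i |-> u]).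

Definition alternating p (f : ('I_p -> V) -> R) : Prop :=
  forall x i j, i != j -> x i = x j -> f x = 0.

Definition exterior_form p (f : ('I_p -> V) -> R) : Prop :=
  multilinear f /\ alternating f.

(* By the universal property of the exterior powers, a bilinear form          *)
(* omega : /\^p V x /\^q V -> R is the same thing as the map                  *)
(* x, y |-> omega(x_1 /\ ... /\ x_p, y_1 /\ ... /\ y_q), multilinear and      *)
(* alternating in each of the two families of vectors x and y.                *)
Record dform p q := DForm {
  dform_fun :> ('I_p -> V) -> ('I_q -> V) -> R;
  dform_l : forall y, exterior_form (dform_fun^~ y);
  dform_r : forall x, exterior_form (dform_fun x) }.

Lemma exterior_form_sum p (I : Type) (r : seq I) (P : pred I) (c : I -> R)
    (F : I -> ('I_p -> V) -> R) :
  (forall i, exterior_form (F i)) ->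
  exterior_form (fun x => \sum_(i <- r | P i) c i * F i x).
Proof.
move=> hF; split=> [x k a u v | x j k jk xjk].
  rewrite mulr_sumr -big_split /=; apply: eq_bigr => i _.
  by rewrite (hF i).1 mulrDr !mulrA (mulrC a).
by apply: big1 => i _; rewrite ((hF i).2 x j k) ?mulr0.
Qed.

Lemma exterior_form_scale p (c : R) (f : ('I_p -> V) -> R) :
  exterior_form f -> exterior_form (fun x => c * f x).
Proof.
move=> [hl ha]; split=> [x k a u v | x j k jk xjk].
  by rewrite hl mulrDr !mulrA (mulrC a).
by rewrite (ha x j k) ?mulr0.
Qed.

Definition lpart p r (x : 'I_(p + r) -> V) : 'I_p -> V :=
  fun i => x (lshift r i).
Definition rpart p r (x : 'I_(p + r) -> V) : 'I_r -> V :=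
  fun i => x (rshift p i).

Definition alt_sum p r (a : ('I_p -> V) -> R) (b : ('I_r -> V) -> R)
    (x : 'I_(p + r) -> V) : R :=
  \sum_(s : 'S_(p + r)) (-1) ^+ s * (a (lpart (x \o s)) * b (rpart (x \o s))).

(* (theta /\ eta)(x_1, .., x_(p+r)), normalised so that the value of          *)
(* theta_1 /\ ... /\ theta_p at (x_1, .., x_p) is the determinant of the      *)
(* matrix of the theta_i(x_j) when the theta_i are of degree 1.               *)
Definition wedge p r (a : ('I_p -> V) -> R) (b : ('I_r -> V) -> R)
    (x : 'I_(p + r) -> V) : R :=
  (p`!%:R * r`!%:R)^-1 * alt_sum a b x.

Definition tensor p q (a : ('I_p -> V) -> R) (b : ('I_q -> V) -> R)
    (x : 'I_p -> V) (y : 'I_q -> V) : R := a x * b y.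

Definition dmul_fun p q r s (w1 : ('I_p -> V) -> ('I_q -> V) -> R)
    (w2 : ('I_r -> V) -> ('I_s -> V) -> R)
    (x : 'I_(p + r) -> V) (y : 'I_(q + s) -> V) : R :=
  (p`!%:R * r`!%:R)^-1 * (q`!%:R * s`!%:R)^-1 *
  \sum_(f : 'S_(p + r)) \sum_(h : 'S_(q + s)) (-1) ^+ f * (-1) ^+ h *
     (w1 (lpart (x \o f)) (lpart (y \o h)) *
      w2 (rpart (x \o f)) (rpart (y \o h))).

(* (th1 (x) th2)(th3 (x) th4) = (th1 /\ th3) (x) (th2 /\ th4); as dmul_fun is *)
(* visibly bilinear in w1 and w2, this identity determines it.                *)
Lemma dmul_fun_tensor p q r s
    (th1 : ('I_p -> V) -> R) (th2 : ('I_q -> V) -> R)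
    (th3 : ('I_r -> V) -> R) (th4 : ('I_s -> V) -> R) x y :
  dmul_fun (tensor th1 th2) (tensor th3 th4) x y =
  tensor (wedge th1 th3) (wedge th2 th4) x y.
Proof.
rewrite /dmul_fun /tensor /wedge /alt_sum mulrACA; congr (_ * _).
rewrite mulr_suml; apply: eq_bigr => f _; rewrite mulr_sumr.
apply: eq_bigr => h _; rewrite [X in _ * X]mulrACA; exact: mulrACA.
Qed.

Lemma alt_sum_exterior p r (a : ('I_p -> V) -> R) (b : ('I_r -> V) -> R) :
  multilinear a -> multilinear b -> exterior_form (alt_sum a b).
Proof.
move=> ha hb; split=> [x i c u v | x i j ij xij].
  rewrite /alt_sum mulr_sumr -big_split /=; apply: eq_bigr => s _.
  rewrite [c * _]mulrCA -mulrDr; congr (_ * _).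
  have [k sk] : exists k, s k = i by exists ((s^-1)%g i); rewrite permKV.
  have upd w (m : 'I_(p + r)) : ([eta x with i |-> w] \o s) m =
      if m == k then w else x (s m).
    by rewrite /= -sk (inj_eq perm_inj).
  move: sk upd; case: (split_ordP k) => {}k -> sk upd.
  - have El w : lpart ([eta x with i |-> w] \o s) =
                [eta lpart (x \o s) with k |-> w].
      by apply/funext => m; rewrite /lpart upd /= (inj_eq (@lshift_inj _ _)).
    have Er w : rpart ([eta x with i |-> w] \o s) = rpart (x \o s).
      by apply/funext => m; rewrite /rpart upd eq_rlshift.
    by rewrite !El !Er ha mulrDl mulrA.
  - have El w : rpart ([eta x with i |-> w] \o s) =
                [eta rpart (x \o s) with k |-> w].
      by apply/funext => m; rewrite /rpart upd /= (inj_eq (@rshift_inj _ _)).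
    have Er w : lpart ([eta x with i |-> w] \o s) = lpart (x \o s).
      by apply/funext => m; rewrite /lpart upd eq_lrshift.
    by rewrite !El !Er hb mulrDr mulrCA.
suff E : alt_sum a b x = - alt_sum a b x.
  by apply/eqP; rewrite -[_ == 0]/((2 == 0)%N || _) -mulrn_eq0 mulr2n {1}E addNr.
rewrite {1}/alt_sum (reindex_inj (mulIg (tperm i j))) /= -sumrN.
apply: eq_bigr => s _; rewrite odd_permM odd_tperm ij signr_addb expr1 mulrN1.
rewrite mulNr; congr (- (_ * _)).
suff -> : x \o (s * tperm i j)%g = x \o s by [].
apply/funext => m; rewrite /= permM.
by case: tpermP => [->|->|//]; rewrite xij.
Qed.

Lemma dmul_fun_l p q r s (w1 : dform p q) (w2 : dform r s) y :
  exterior_form ((dmul_fun w1 w2)^~ y).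
Proof.
apply: exterior_form_scale.
have -> : (fun x => \sum_(f : 'S_(p + r)) \sum_(h : 'S_(q + s))
   (-1) ^+ f * (-1) ^+ h *
     (w1 (lpart (x \o f)) (lpart (y \o h)) *
      w2 (rpart (x \o f)) (rpart (y \o h)))) =
  (fun x => \sum_(h : 'S_(q + s)) (-1) ^+ h *
     alt_sum (w1^~ (lpart (y \o h))) (w2^~ (rpart (y \o h))) x).
  apply/funext => x; rewrite exchange_big /=; apply: eq_bigr => h _.
  by rewrite mulr_sumr; apply: eq_bigr => f _; rewrite mulrA (mulrC (_ ^+ h)).
apply: exterior_form_sum => h; apply: alt_sum_exterior.
  exact: (dform_l w1 _).1.
exact: (dform_l w2 _).1.
Qed.

Lemma dmul_fun_r p q r s (w1 : dform p q) (w2 : dform r s) x :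
  exterior_form (dmul_fun w1 w2 x).
Proof.
apply: exterior_form_scale.
have -> : (fun y => \sum_(f : 'S_(p + r)) \sum_(h : 'S_(q + s))
   (-1) ^+ f * (-1) ^+ h *
     (w1 (lpart (x \o f)) (lpart (y \o h)) *
      w2 (rpart (x \o f)) (rpart (y \o h)))) =
  (fun y => \sum_(f : 'S_(p + r)) (-1) ^+ f *
     alt_sum (w1 (lpart (x \o f))) (w2 (rpart (x \o f))) y).
  apply/funext => y; apply: eq_bigr => f _.
  by rewrite mulr_sumr; apply: eq_bigr => h _; rewrite mulrA.
apply: exterior_form_sum => f; apply: alt_sum_exterior.
  exact: (dform_r w1 _).1.
exact: (dform_r w2 _).1.
Qed.

Definition dmul p q r s (w1 : dform p q) (w2 : dform r s) :
    dform (p + r) (q + s) :=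
  DForm (dmul_fun_l w1 w2) (dmul_fun_r w1 w2).

Lemma exterior_form_deg0 (c : R) : exterior_form (fun _ : 'I_0 -> V => c).
Proof. by split=> x []. Qed.

Definition dform_one : dform 0 0 :=
  @DForm 0 0 (fun _ _ => 1)
    (fun _ => exterior_form_deg0 1) (fun _ => exterior_form_deg0 1).

Fixpoint dpow (w : dform 1 1) m : dform m m :=
  if m is m'.+1 then dmul w (dpow w m') else dform_one.

Definition dscale p q (c : R) (w : dform p q) : dform p q :=
  DForm (fun y => exterior_form_scale c (dform_l w y))
        (fun x => exterior_form_scale c (dform_r w x)).

Lemma exterior_form_deg1 (f : V -> R) :
  scalar f -> exterior_form (fun x : 'I_1 -> V => f (x ord0)).
Proof.
move=> hf; split=> [x i a u v | x i j]; last by rewrite !ord1 eqxx.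
by rewrite /= !ord1 hf.
Qed.

Definition dform_of_bilin (b : {biscalar V}) : dform 1 1 :=
  @DForm 1 1 (fun x y => b (x ord0) (y ord0))
    (fun y => exterior_form_deg1 (linearPl b (y ord0)))
    (fun x => exterior_form_deg1 (linearPr b (x ord0))).

Definition bilin_of_dform (w : dform 1 1) : V -> V -> R :=
  fun x y => w (fun=> x) (fun=> y).

End DoubleForms.

Section Euclidean.
Variables (R : realFieldType) (n : nat) (V : vectType R).
Variables (g : {dot V for idfun}) (e : 'I_n -> V).

(* In this section e is meant to be an orthonormal basis of (V, g); it also   *)
(* fixes the orientation of V used by the Hodge star.                         *)
Definition orthonormal_basis : Prop :=
  \dim {:V} = n /\ forall i j, g (e i) (e j) = (i == j)%:R.

Definition vol (x : 'I_n -> V) : R := \det (\matrix_(i, j) g (x i) (e j)).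

Definition vcat q p (x : 'I_q -> V) (y : 'I_p -> V) (i : 'I_(q + p)) : V :=
  match split i with inl j => x j | inr j => y j end.

Definition increasing p (I : {ffun 'I_p -> 'I_n}) : bool :=
  [forall i : 'I_p, forall j : 'I_p, (i < j)%N ==> (I i < I j)%N].

(* For u = x_1 /\ .. /\ x_q with q + p = n, the usual Hodge star *u is the    *)
(* p-vector such that <*u, w> = vol(u /\ w) for every p-vector w. Its         *)
(* coordinate on the element e_I = e_(I 0) /\ .. /\ e_(I (p-1)) of the        *)
(* orthonormal basis (e_I)_(I increasing) of /\^p V is thus vol(u /\ e_I).    *)
Definition hodge_coord q p (qp : (q + p)%N = n) (x : 'I_q -> V)
    (I : {ffun 'I_p -> 'I_n}) : R :=
  vol (fun i => vcat x (e \o I) (cast_ord (esym qp) i)).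

(* ( *omega)(u, v) = omega( *u, *v), expanding *u and *v on the basis (e_I).  *)
Definition hstar_fun q p (qp : (q + p)%N = n) (w : dform V p p)
    (x y : 'I_q -> V) : R :=
  \sum_(I : {ffun 'I_p -> 'I_n} | increasing I)
  \sum_(J : {ffun 'I_p -> 'I_n} | increasing J)
    hodge_coord qp x I * hodge_coord qp y J * w (e \o I) (e \o J).

Lemma hodge_coord_exterior q p (qp : (q + p)%N = n) I :
  exterior_form (fun x : 'I_q -> V => @hodge_coord q p qp x I).
Proof.
set l := fun i : 'I_q => cast_ord qp (lshift p i).
have vc (x : 'I_q -> V) i : vcat x (e \o I) (cast_ord (esym qp) (l i)) = x i.
  by rewrite cast_ordK /vcat -[lshift p i]/(unsplit (inl i)) unsplitK.
have l_inj : injective l by move=> i j /cast_ord_inj/lshift_inj.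
split=> [x i a u v | x i j ij xij]; last first.
  apply: (@determinant_alternate _ _ _ (l i) (l j)) => [|k].
    by rewrite (inj_eq l_inj).
  by rewrite !mxE !vc xij.
have off w w' k : k != l i ->
    vcat [eta x with i |-> w] (e \o I) (cast_ord (esym qp) k) =
    vcat [eta x with i |-> w'] (e \o I) (cast_ord (esym qp) k).
  rewrite -(inj_eq (@cast_ord_inj _ _ (esym qp))) cast_ordK.
  case: (split_ordP (cast_ord (esym qp) k)) => k' -> nk.
    rewrite /vcat -[lshift p k']/(unsplit (inl k')) unsplitK /=.
    by rewrite -(inj_eq (@lshift_inj _ p)) (negbTE nk).
  by rewrite /vcat -[rshift q k']/(unsplit (inr k')) unsplitK.
rewrite -[X in _ = _ + X]mul1r.
apply: (@determinant_multilinear _ _ _ _ _ (l i)).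
- by apply/rowP => k; rewrite !mxE !vc /= eqxx mul1r linearPl.
- apply/matrixP => k m; rewrite !mxE.
  by rewrite (off _ (a *: u + v)) // eq_sym neq_lift.
- apply/matrixP => k m; rewrite !mxE.
  by rewrite (off _ (a *: u + v)) // eq_sym neq_lift.
Qed.

Lemma hstar_fun_l q p (qp : (q + p)%N = n) (w : dform V p p) y :
  exterior_form ((@hstar_fun q p qp w)^~ y).
Proof.
have -> : (@hstar_fun q p qp w)^~ y = (fun x => \sum_(I | increasing I)
    (\sum_(J | increasing J) hodge_coord qp y J * w (e \o I) (e \o J)) *
      hodge_coord qp x I).
  apply/funext => x; apply: eq_bigr => I _; rewrite mulr_suml.
  by apply: eq_bigr => J _; rewrite -mulrA mulrC.
by apply: exterior_form_sum => I; apply: hodge_coord_exterior.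
Qed.

Lemma hstar_fun_r q p (qp : (q + p)%N = n) (w : dform V p p) x :
  exterior_form (@hstar_fun q p qp w x).
Proof.
have -> : @hstar_fun q p qp w x = (fun y => \sum_(J | increasing J)
    (\sum_(I | increasing I) hodge_coord qp x I * w (e \o I) (e \o J)) *
      hodge_coord qp y J).
  apply/funext => y; rewrite /hstar_fun exchange_big; apply: eq_bigr => J _.
  by rewrite mulr_suml; apply: eq_bigr => I _; rewrite mulrAC.
by apply: exterior_form_sum => J; apply: hodge_coord_exterior.
Qed.

Definition hstar q p (qp : (q + p)%N = n) (w : dform V p p) : dform V q q :=
  DForm (hstar_fun_l qp w) (hstar_fun_r qp w).

Definition bilin_inner (a b : V -> V -> R) : R :=
  \sum_i \sum_j a (e i) (e j) * b (e i) (e j).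

(* The matrix, in the basis e, of the operator corresponding to b via g.      *)
Definition bilin_mx (b : V -> V -> R) : 'M[R]_n := \matrix_(i, j) b (e i) (e j).

Definition bilin_det (b : V -> V -> R) : R := \det (bilin_mx b).

(* det(b - lambda I), as a polynomial in lambda.                              *)
Definition bilin_char_poly (b : V -> V -> R) : {poly R} :=
  \det (map_mx polyC (bilin_mx b) - 'X%:M).

Definition char_coef (b : V -> V -> R) (k : nat) : R :=
  (-1) ^+ (n - k) * (bilin_char_poly b)`_(n - k).

Lemma bilin_char_polyE (b : V -> V -> R) :
  bilin_char_poly b =
  \sum_(k < n.+1) ((-1) ^+ (n - k) * char_coef b k) *: 'X^(n - k).
Proof.
have sz : (size (bilin_char_poly b) <= n.+1)%N.
  rewrite /bilin_char_poly -opprB -scaleN1r detZ -signr_odd.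
  rewrite -(size_char_poly (bilin_mx b)).
  by case: (odd n); rewrite ?expr1 ?mulN1r ?size_polyN ?mul1r.
rewrite -[LHS](take_poly_id sz) /take_poly poly_def (reindex_inj rev_ord_inj) /=.
apply: eq_bigr => k _; rewrite subSS /char_coef mulrA -exprD.
by rewrite addnn -signr_odd odd_double mul1r.
Qed.

Lemma tf_degree k : (k < n)%N -> (1 + ((n - 1 - k) + k))%N = n.
Proof. by move=> kn; rewrite addnCA -subnDA subnK. Qed.

Definition newton_tf (b : {biscalar V}) k (kn : (k < n)%N) : dform V 1 1 :=
  dscale (k`!%:R * (n - 1 - k)`!%:R)^-1
    (hstar (tf_degree kn)
       (dmul (dpow (dform_of_bilin g) (n - 1 - k)) (dpow (dform_of_bilin b) k))).

End Euclidean.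

Arguments newton_tf {R n V} g e b k kn.

Lemma pred_ltn n k : (0 < k <= n)%N -> (k.-1 < n)%N.
Proof. by case: k. Qed.

Lemma pred_ltnn n : (0 < n)%N -> (n.-1 < n)%N.
Proof. by case: n. Qed.

(* Main.v *)
(* Expanding both factors, the double form g^m h^k evaluated at (x, y) is     *)
(* m! k! times the coefficient of X^m in det(X g(x_i, y_j) + h(x_i, y_j)).    *)
(* In degree n - 1 the Hodge star keeps only the complements of one index     *)
(* on each side, so t_k(h)(e_i, e_j) is the coefficient of X^(n-1-k) in the   *)
(* (i, j) cofactor of X + h.  Since s_k(h) is the coefficient of X^(n-k) in   *)
(* det(X + h), the formula is Jacobi's rule                                   *)
(* d(det M) = \sum_(i, j) cofactor_ij(M) dM_ij, read coefficientwise.         *)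
Require Import Defs.
From mathcomp Require Import all_boot all_order all_algebra all_fingroup.
From mathcomp Require Import ring zify.
From mathcomp Require Import all_classical all_reals all_analysis.
Import Order.TTheory GRing.Theory Num.Theory.
Import numFieldNormedType.Exports.
Local Open Scope ring_scope.

(** Everything is read off one polynomial determinant, det(X + h) with h written in the orthonormal
    basis [e].

    The core is combinatorial: the double sum over permutations defining g^m h^k counts each term of
    a determinant many times. [sum_perm_det_minors] absorbs the permutations inside the two factors
    into the outer ones, [sum_perm_pairs] merges the outer pair into one relative permutation
    carrying the sign, and [sum_perm_prod_split] recognises what is left as a coefficient of a
    product of linear polynomials. This gives [dmul_dpow_bilinE].

    On single basis vectors the Hodge star deletes one row and one column, with the cofactor sign
    ([hstar1E]). Hence t_k is a coefficient of a cofactor of X + h ([newton_tfE]), while s_k is a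
    coefficient of the determinant ([char_coefE]). Jacobi's formula ([coef_derive_det]) links the
    two: X does not vary with time, so the derivative of X + h has constant polynomial entries and
    taking a coefficient passes to the cofactor. *)

(** * Double permutation sums of complementary minors *)

Definition perm_sum_fun {p r} (s : 'S_p) (u : 'S_r) (i : 'I_(p + r)) :
    'I_(p + r) :=
  match fintype.split i with
  | inl j => lshift r (s j)
  | inr j => rshift p (u j)
  end.

Lemma perm_sum_funL {p r} (s : 'S_p) (u : 'S_r) i :
  perm_sum_fun s u (lshift r i) = lshift r (s i).
Proof. by rewrite /perm_sum_fun -[lshift r i]/(unsplit (inl i)) unsplitK. Qed.

Lemma perm_sum_funR {p r} (s : 'S_p) (u : 'S_r) i :
  perm_sum_fun s u (rshift p i) = rshift p (u i).
Proof. by rewrite /perm_sum_fun -[rshift p i]/(unsplit (inr i)) unsplitK. Qed.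

Lemma perm_sum_inj {p r} (s : 'S_p) (u : 'S_r) : injective (perm_sum_fun s u).
Proof.
move=> i j; case: (split_ordP i) => i' ->; case: (split_ordP j) => j' ->;
  rewrite ?perm_sum_funL ?perm_sum_funR => /eqP;
  rewrite ?eq_lshift ?eq_rshift ?eq_lrshift ?eq_rlshift //.
  by move=> /eqP/perm_inj ->.
by move=> /eqP/perm_inj ->.
Qed.

Definition perm_sum {p r} (s : 'S_p) (u : 'S_r) : 'S_(p + r) :=
  perm (@perm_sum_inj p r s u).

Lemma perm_sumL {p r} (s : 'S_p) (u : 'S_r) i :
  perm_sum s u (lshift r i) = lshift r (s i).
Proof. by rewrite permE perm_sum_funL. Qed.

Lemma perm_sumR {p r} (s : 'S_p) (u : 'S_r) i :
  perm_sum s u (rshift p i) = rshift p (u i).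
Proof. by rewrite permE perm_sum_funR. Qed.

(** The matrix of [perm_sum s u] is block diagonal, so its determinant is the product of the two
    blocks' determinants. *)
Lemma sign_perm_sum (R : comPzRingType) {p r} (s : 'S_p) (u : 'S_r) :
  (-1) ^+ perm_sum s u = (-1) ^+ s * (-1) ^+ u :> R.
Proof.
rewrite -!det_perm -(det_ublock _ 0); congr (\det _).
apply/matrixP => i j.
by case: (split_ordP i) => i' ->; case: (split_ordP j) => j' ->;
  rewrite ?block_mxEul ?block_mxEur ?block_mxEdl ?block_mxEdr !mxE
    ?perm_sumL ?perm_sumR ?eq_lshift ?eq_rshift ?eq_lrshift ?eq_rlshift.
Qed.

Lemma sum_perm_det_minors (R : comPzRingType) p r (G H : 'M[R]_(p + r)) :
  \sum_(f : 'S_(p + r)) \sum_(h : 'S_(p + r)) (-1) ^+ f * (-1) ^+ h *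
    (\det (\matrix_(i, j) G (f (lshift r i)) (h (lshift r j))) *
     \det (\matrix_(i, j) H (f (rshift p i)) (h (rshift p j)))) =
  (p`! * r`!)%:R * \sum_(f : 'S_(p + r)) \sum_(h : 'S_(p + r))
    (-1) ^+ f * (-1) ^+ h *
    (\prod_i G (f (lshift r i)) (h (lshift r i)) *
     \prod_i H (f (rshift p i)) (h (rshift p i))).
Proof.
rewrite mulr_sumr; apply: eq_bigr => f _.
pose t (h : 'S_(p + r)) := (-1) ^+ f * (-1) ^+ h *
    (\prod_i G (f (lshift r i)) (h (lshift r i)) *
     \prod_i H (f (rshift p i)) (h (rshift p i))).
(* Each pair ([s], [u]) from the Leibniz expansions of the two minors can be absorbed into [h] as
   [perm_sum s u * h], so all p! r! pairs contribute the same sum. *)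
transitivity (\sum_(s : 'S_p) \sum_(u : 'S_r) \sum_h t h); last first.
  by rewrite !sumr_const !card_Sn -mulrnA mulr_natl mulnC.
under [RHS]eq_bigr => s _ do under eq_bigr => u _ do
  rewrite (reindex_inj (mulgI (perm_sum s u))).
under [RHS]eq_bigr => s _ do rewrite exchange_big.
rewrite [RHS]exchange_big; apply: eq_bigr => h _.
rewrite /determinant mulr_suml mulr_sumr; apply: eq_bigr => s _.
rewrite !mulr_sumr; apply: eq_bigr => u _.
rewrite /t odd_permM signr_addb sign_perm_sum.
under eq_bigr do rewrite mxE; set X := \prod_i _.
under eq_bigr do rewrite mxE; set Y := \prod_i _.
under eq_bigr do rewrite permM perm_sumL; rewrite -/X.
under eq_bigr do rewrite permM perm_sumR; rewrite -/Y.
rewrite [X in _ * X]mulrACA [LHS]mulrA; congr (_ * _).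
by rewrite -!mulrA; congr (_ * _); rewrite mulrC -mulrA.
Qed.

Lemma perm_card_eq n (S T : {set 'I_n}) :
  #|S| = #|T| -> exists s : 'S_n, forall i, (i \in S) = (s i \in T).
Proof.
move=> ST.
(* A Boolean tuple is determined up to reordering by its counts, and those of an indicator depend
   only on the cardinal; the reordering is the permutation sought. *)
have cnt (A : {set 'I_n}) (P : pred bool) :
    count P [tuple i \in A | i < n] = (P true * #|A| + P false * (n - #|A|))%N.
  have -> : count P [tuple i \in A | i < n] = #|[pred i | P (i \in A)]|.
    rewrite /= count_map -size_filter cardE /enum_mem -enumT -filter_predI.
    by congr size; apply: eq_filter => i; rewrite /= !inE andbT.
  have CA : (n - #|A|)%N = #|~: A|.
    by rewrite [RHS]cardsCs finset.setCK card_ord.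
  case P1: (P true); case P0: (P false); rewrite ?mul1n ?mul0n ?addn0 ?CA.
  - by rewrite cardsC; apply: eq_card => i; rewrite !inE; case: (i \in A).
  - by apply: eq_card => i; rewrite !inE; case: (i \in A).
  - by apply: eq_card => i; rewrite !inE; case: (i \in A).
  - by apply: eq_card0 => i; rewrite !inE; case: (i \in A).
have /tuple_permP [s Es] :
    perm_eq [tuple i \in S | i < n] [tuple i \in T | i < n].
  by apply/seq.permP => P; rewrite !cnt ST.
exists s => i.
have /(congr1 (fun t => tnth t i)) : [tuple i \in S | i < n] =
  [tuple tnth [tuple i \in T | i < n] (s i) | i < n] by apply: val_inj.
by rewrite !tnth_mktuple.
Qed.

Lemma coef_prod_linear (R : comNzRingType) (I : finType) (a b : I -> R) m :
  (\prod_i (a i *: 'X + (b i)%:P))`_m =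
  \sum_(S : {set I} | #|S| == m) \prod_i (if i \in S then a i else b i).
Proof.
rewrite bigA_distr /= coef_sum [RHS]big_mkcond /=; apply: eq_bigr => S _.
have -> : \prod_i (if i \in S then a i *: 'X else (b i)%:P) =
    (\prod_i (if i \in S then a i else b i)) *: 'X^#|S|.
  transitivity (\prod_i ((if i \in S then a i else b i) *: 'X^(i \in S))).
    by apply: eq_bigr => i _; case: ifP => _; rewrite ?expr0 ?alg_polyC.
  rewrite scaler_prod prodrXr -sum1_card; congr (_ *: 'X^_).
  by rewrite [RHS]big_mkcond; apply: eq_bigr => i _; case: (i \in S).
rewrite coefZ coefXn eq_sym; case: eqP; rewrite ?mulr1 ?mulr0 //.
Qed.

(** The coefficient sums over the sets of m indices taking the factor [a]. A permutation [f] chooses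
    such a set as the image of the first m indices, and each set is chosen m! k! times; the proof
    obtains this by averaging over all sets [S]. *)
Lemma sum_perm_prod_split (R : numDomainType) m k (a b : 'I_(m + k) -> R) :
  \sum_(f : 'S_(m + k))
    \prod_i a (f (lshift k i)) * \prod_i b (f (rshift m i)) =
  (m`! * k`!)%:R * (\prod_i (a i *: 'X + (b i)%:P))`_m.
Proof.
pose L := [set i : 'I_(m + k) | (i < m)%N].
have cardL : #|L| = m.
  rewrite -sum1_card big_split_ord (eq_bigl predT) => [|i]; last first.
    by rewrite inE /= ltn_ord.
  rewrite /= [X in (_ + X)%N]big_pred0 => [|i]; last first.
    by rewrite inE /= ltnNge leq_addr.
  by rewrite addn0 sum1_card card_ord.
pose t (S : {set 'I_(m + k)}) (f : 'S_(m + k)) :=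
  \prod_i (if i \in S then a (f i) else b (f i)).
have -> : \sum_(f : 'S_(m + k))
    \prod_i a (f (lshift k i)) * \prod_i b (f (rshift m i)) = \sum_f t L f.
  apply: eq_bigr => f _; rewrite /t big_split_ord /=; congr (_ * _).
    by apply: eq_bigr => i _; rewrite inE /= ltn_ord.
  by apply: eq_bigr => i _; rewrite inE /= ltnNge leq_addr.
have tS (S : {set 'I_(m + k)}) : #|S| = m -> \sum_f t S f = \sum_f t L f.
  move=> cardS; have /perm_card_eq [s sE] := etrans cardS (esym cardL).
  rewrite [LHS](reindex_inj (mulgI s)); apply: eq_bigr => f _.
  rewrite /t [RHS](reindex_inj (@perm_inj _ s)); apply: eq_bigr => i _.
  by rewrite -sE !permM.
(* By symmetry every S contributes as much as L; sum over all S of size m. *)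
have sumt : \sum_(S : {set 'I_(m + k)} | #|S| == m) \sum_f t S f =
    (m + k)`!%:R * (\prod_i (a i *: 'X + (b i)%:P))`_m.
  rewrite exchange_big /= -card_Sn mulr_natl -sumr_const; apply: eq_bigr => f _.
  rewrite (reindex_inj (@perm_inj _ f)) /=.
  by rewrite (coef_prod_linear _ _ (a \o f) (b \o f)).
(* There are C(m + k, m) sets of size m, and C(m + k, m) m! k! = (m + k)!. *)
have Cn0 : 'C(m + k, m)%:R != 0 :> R.
  by rewrite pnatr_eq0 -lt0n bin_gt0 leq_addr.
apply: (mulfI Cn0); rewrite mulrA -natrM.
have := bin_fact (leq_addr k m); rewrite addKn => ->.
rewrite -sumt [RHS](eq_bigr (fun=> \sum_f t L f)) => [|S /eqP]; last first.
  exact: tS.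
rewrite sumr_const mulr_natl; congr (_ *+ _).
by rewrite -[in LHS](card_ord (m + k)) -card_draws cardsE.
Qed.

(** Substituting h = s o f leaves only the sign of [s]. *)
Lemma sum_perm_pairs (R : comPzRingType) p r (G H : 'M[R]_(p + r)) :
  \sum_(f : 'S_(p + r)) \sum_(h : 'S_(p + r)) (-1) ^+ f * (-1) ^+ h *
    (\prod_i G (f (lshift r i)) (h (lshift r i)) *
     \prod_i H (f (rshift p i)) (h (rshift p i))) =
  \sum_(s : 'S_(p + r)) (-1) ^+ s * \sum_(f : 'S_(p + r))
    (\prod_i G (f (lshift r i)) (s (f (lshift r i))) *
     \prod_i H (f (rshift p i)) (s (f (rshift p i)))).
Proof.
under [RHS]eq_bigr do rewrite mulr_sumr.
rewrite [RHS]exchange_big; apply: eq_bigr => f _.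
rewrite (reindex_inj (mulgI f)); apply: eq_bigr => s _.
rewrite odd_permM signr_addb mulrA -expr2 sqrr_sign mul1r.
by congr (_ * (_ * _)); apply: eq_bigr => i _; rewrite permM.
Qed.

(** A Laplace expansion averaged over all choices of rows and columns: with equal factors the two
    block products combine into the full product of the [W i (s i)], whatever [f] is. *)
Lemma sum_perm_det_minors_diag (R : comPzRingType) p r (W : 'M[R]_(p + r)) :
  \sum_(f : 'S_(p + r)) \sum_(h : 'S_(p + r)) (-1) ^+ f * (-1) ^+ h *
    (\det (\matrix_(i, j) W (f (lshift r i)) (h (lshift r j))) *
     \det (\matrix_(i, j) W (f (rshift p i)) (h (rshift p j)))) =
  (p`! * r`!)%:R * (p + r)`!%:R * \det W.
Proof.
rewrite sum_perm_det_minors sum_perm_pairs -mulrA; congr (_ * _).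
rewrite /determinant mulr_sumr; apply: eq_bigr => s _.
rewrite mulrCA; congr (_ * _).
rewrite -card_Sn mulr_natl -sumr_const; apply: eq_bigr => f _.
by rewrite [RHS](reindex_inj (@perm_inj _ f)) [RHS]big_split_ord.
Qed.

Lemma sum_perm_det_minors_coef (R : numDomainType) p r (G H : 'M[R]_(p + r)) :
  \sum_(f : 'S_(p + r)) \sum_(h : 'S_(p + r)) (-1) ^+ f * (-1) ^+ h *
    (\det (\matrix_(i, j) G (f (lshift r i)) (h (lshift r j))) *
     \det (\matrix_(i, j) H (f (rshift p i)) (h (rshift p j)))) =
  (p`! * r`!)%:R ^+ 2 *
    (\det (\matrix_(i, j) (G i j *: 'X + (H i j)%:P)))`_p.
Proof.
rewrite sum_perm_det_minors sum_perm_pairs expr2 -mulrA; congr (_ * _).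
rewrite /determinant coef_sum mulr_sumr; apply: eq_bigr => s _.
rewrite (sum_perm_prod_split _ _ _ (fun i => G i (s i)) (fun i => H i (s i))).
rewrite mulrCA; congr (_ * _); under [in RHS]eq_bigr do rewrite mxE.
by case: (odd_perm s); rewrite ?expr1 ?expr0 ?mul1r ?mulN1r ?coefN.
Qed.

(** * Powers and products of bilinear forms as determinants *)

Lemma factr_neq0 (R : numDomainType) m : m`!%:R != 0 :> R.
Proof. by rewrite pnatr_eq0 -lt0n fact_gt0. Qed.

Lemma dpow_bilinE (R : realFieldType) (V : lmodType R) (b : {biscalar V}) m
    x y :
  dpow (dform_of_bilin b) m x y =
  m`!%:R * \det (\matrix_(i < m, j < m) b (x i) (y j)).
Proof.
elim: m x y => [|m IHm] x y; first by rewrite /= det_mx00 mulr1.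
rewrite /= /dmul_fun.
under eq_bigr => f _ do under eq_bigr => h _ do rewrite IHm.
pose W : 'M[R]_(1 + m) := \matrix_(i, j) b (x i) (y j).
have := sum_perm_det_minors_diag R 1 m W.
rewrite mul1n => E.
(* One m! comes from the induction hypothesis, the rest from the averaged Laplace expansion; the
   normalisation 1/(m!)^2 of the product leaves (1 + m)!. *)
rewrite (_ : \sum_f _ = m`!%:R * (m`!%:R * (1 + m)`!%:R * \det W)).
  have := factr_neq0 R m; set P := m`!%:R => P0; set Q := (1 + m)`!%:R.
  by rewrite -[\det (\matrix_(_, _) _)]/(\det W) -[1`!%:R]/1; field.
rewrite -E mulr_sumr; apply: eq_bigr => f _; rewrite mulr_sumr.
apply: eq_bigr => h _; rewrite det_mx11 !mxE.
have -> : \matrix_(i, j) b (rpart (x \o f) i) (rpart (y \o h) j) =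
   (\matrix_(i, j) W (f (rshift 1 i)) (h (rshift 1 j))).
  by apply/matrixP => i j; rewrite !mxE.
rewrite [RHS]mulrCA; congr (_ * _); rewrite mulrCA; congr (_ * (_ * _)).
Qed.

Lemma dmul_dpow_bilinE (R : realFieldType) (V : lmodType R) (a b : {biscalar V})
    m k x y :
  dmul (dpow (dform_of_bilin a) m) (dpow (dform_of_bilin b) k) x y =
  m`!%:R * k`!%:R * (\det (\matrix_(i, j)
     (a (x i) (y j) *: 'X + (b (x i) (y j))%:P)))`_m.
Proof.
pose G : 'M[R]_(m + k) := \matrix_(i, j) a (x i) (y j).
pose H : 'M[R]_(m + k) := \matrix_(i, j) b (x i) (y j).
have -> : \matrix_(i, j) (a (x i) (y j) *: 'X + (b (x i) (y j))%:P) =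
    \matrix_(i, j) (G i j *: 'X + (H i j)%:P).
  by apply/matrixP => i j; rewrite !mxE.
have E := sum_perm_det_minors_coef R m k G H.
rewrite /= /dmul_fun.
under eq_bigr => f _ do under eq_bigr => h _ do rewrite !dpow_bilinE.
rewrite (_ : \sum_f _ = m`!%:R * k`!%:R * ((m`! * k`!)%:R ^+ 2 *
    (\det (\matrix_(i, j) (G i j *: 'X + (H i j)%:P)))`_m)).
  have := factr_neq0 R m; have := factr_neq0 R k; rewrite natrM.
  by set P := m`!%:R; set Q := k`!%:R => P0 Q0; field; apply/andP.
rewrite -E mulr_sumr; apply: eq_bigr => f _; rewrite mulr_sumr.
apply: eq_bigr => h _; rewrite [RHS]mulrCA; congr (_ * _).
rewrite [LHS]mulrACA; congr (_ * (_ * _)); congr (\det _);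
  by apply/matrixP => i j; rewrite !mxE.
Qed.

(** * The Hodge star onto (1,1) double forms *)

Lemma increasing_eq_lift p (I : {ffun 'I_p -> 'I_(1 + p)}) (i : 'I_(1 + p)) :
  increasing I -> (forall a, I a != i) -> I = [ffun a => lift i a].
Proof.
move=> incI nI.
have incP (a b : 'I_p) : (a < b)%N -> (I a < I b)%N.
  by move=> ab; have /forallP/(_ a)/forallP/(_ b)/implyP := incI; apply.
have inc_sorted (F : 'I_p -> 'I_(1 + p)) :
    (forall a b : 'I_p, (a < b)%N -> (F a < F b)%N) ->
    sorted (fun u v : 'I_(1 + p) => (u < v)%N) (map F (enum 'I_p)).
  move=> incF; rewrite sorted_map.
  apply: (@sub_sorted _ (relpre val ltn)) => //.
  by rewrite -sorted_map val_enum_ord iota_ltn_sorted.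
have injI : injective I.
  move=> a b Iab; apply: val_inj; case: (ltngtP a b) => // /incP;
    by rewrite Iab ltnn.
suff E : map I (enum 'I_p) = map (lift i) (enum 'I_p).
  apply/ffunP => a; rewrite ffunE.
  by have /eq_in_map/(_ a) := E; apply; rewrite mem_enum.
(* Two strictly increasing lists with the same elements are equal; the inclusion of elements is an
   equality because both lists have length p without repetition. *)
apply: (irr_sorted_eq (leT := fun u v : 'I_(1 + p) => (u < v)%N)).
- by move=> u v w; apply: ltn_trans.
- by move=> u; rewrite /= ltnn.
- exact: inc_sorted.
- by apply: inc_sorted => a b ab; rewrite ltnNge leq_bump2 -ltnNge.
have sub : {subset map I (enum 'I_p) <= map (lift i) (enum 'I_p)}.
  move=> _ /mapP [a _ ->]; have : i != I a by rewrite eq_sym nI.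
  by move=> /unlift_some [b -> _]; rewrite map_f // mem_enum.
apply: (uniq_min_size _ sub _).2.
  by rewrite map_inj_uniq ?enum_uniq.
by rewrite !size_map.
Qed.

Section OrthonormalHodge.
Variables (R : realFieldType) (V : vectType R) (g : {dot V for idfun}).

(** Expanding the volume along the row of [e i] leaves one minor with sign (-1)^i. It is the
    identity when [I] enumerates the complement of [i]; otherwise [I] takes the value [i] and the
    minor has a zero row. *)
Lemma hodge_coord1 p (e : 'I_(1 + p) -> V) (qp : (1 + p)%N = (1 + p)%N) i I :
  (forall j k, g (e j) (e k) = (j == k)%:R) -> increasing I ->
  hodge_coord g e qp (fun=> e i) I =
  if I == [ffun a => lift i a] then (-1) ^+ i else 0.
Proof.
move=> oe incI; rewrite /hodge_coord /vol (expand_det_row _ (lshift p ord0)).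
rewrite (bigD1 i) //= big1 => [|j ji]; last first.
  rewrite mxE cast_ord_id /vcat -[lshift p _]/(unsplit (inl _)) unsplitK.
  by rewrite oe eq_sym (negbTE ji) mul0r.
rewrite addr0 mxE cast_ord_id /vcat -[lshift p _]/(unsplit (inl _)) unsplitK.
rewrite oe eqxx mul1r /cofactor -[X in (-1) ^+ X]/(nat_of_ord i).
set M := row' _ _.
have {}M_E a b : M a b = (I a == lift i b)%:R.
  rewrite !mxE cast_ord_id /vcat (_ : lift _ _ = unsplit (inr a)).
    by rewrite unsplitK /= oe.
  by apply: val_inj.
case: eqP => [II|nI].
  rewrite (_ : M = 1%:M) ?det1 ?mulr1 //; apply/matrixP => a b.
  by rewrite M_E II ffunE (inj_eq lift_inj) mxE.
have [/existsP [a /eqP Ia]|/existsPn nIi] := boolP [exists a, I a == i].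
  rewrite (expand_det_row _ a) big1 ?mulr0 // => b _.
  by rewrite M_E Ia (negbTE (neq_lift _ _)) mul0r.
by case: nI; apply: increasing_eq_lift.
Qed.

Lemma lift_increasing p (i : 'I_(1 + p)) :
  increasing [ffun a : 'I_p => lift i a].
Proof.
apply/forallP => a; apply/forallP => b; apply/implyP => ab.
by rewrite !ffunE ltnNge leq_bump2 -ltnNge.
Qed.

Lemma hstar1E p (e : 'I_(1 + p) -> V) (qp : (1 + p)%N = (1 + p)%N)
    (w : dform V p p) i j :
  (forall j k, g (e j) (e k) = (j == k)%:R) ->
  hstar g e qp w (fun=> e i) (fun=> e j) =
  (-1) ^+ (i + j) * w (fun a => e (lift i a)) (fun a => e (lift j a)).
Proof.
move=> oe; rewrite /= /hstar_fun.
rewrite (bigD1 [ffun a => lift i a]) ?lift_increasing //=.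
rewrite [X in _ + X]big1 => [|I /andP [incI nI]]; last first.
  by apply: big1 => J _; rewrite hodge_coord1 // (negbTE nI) !mul0r.
rewrite addr0 (bigD1 [ffun a => lift j a]) ?lift_increasing //=.
rewrite [X in _ + X]big1 => [|J /andP [incJ nJ]]; last first.
  by rewrite [X in _ * X * _]hodge_coord1 // (negbTE nJ) mulr0 mul0r.
rewrite addr0 !hodge_coord1 ?lift_increasing // !eqxx exprD.
by congr (_ * w _ _); apply/funext => a /=; rewrite ffunE.
Qed.

(** The factor 1/(k! m!) cancels the one in [dmul_dpow_bilinE], and orthonormality turns the matrix
    of [g] into the identity. The free exponent [m] allows [n] to be replaced by 1 + (m + k). *)
Lemma newton_tf_coef n (e : 'I_n -> V) (b : {biscalar V}) m k
    (mk : (1 + (m + k))%N = n) i j :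
  (forall j k, g (e j) (e k) = (j == k)%:R) ->
  Defs.dscale (k`!%:R * m`!%:R)^-1
    (hstar g e mk
       (dmul (dpow (dform_of_bilin g) m) (dpow (dform_of_bilin b) k)))
    (fun=> e i) (fun=> e j) =
  (cofactor ('X%:M + map_mx polyC (bilin_mx e b)) i j)`_m.
Proof.
subst n => oe.
rewrite -[LHS]/(_ * dform_fun (hstar _ _ _ _) _ _) hstar1E //.
rewrite dmul_dpow_bilinE [m`!%:R * _]mulrC mulrCA mulKf; last first.
  by rewrite mulf_neq0 ?factr_neq0.
rewrite /cofactor -signr_odd -[in RHS]signr_odd.
have -> : row' i (col' j ('X%:M + map_mx polyC (bilin_mx e b))) =
    \matrix_(a, c) (g (e (lift i a)) (e (lift j c)) *: 'X +
      (b (e (lift i a)) (e (lift j c)))%:P).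
  apply/matrixP => a c; rewrite !mxE oe; congr (_ + _).
  by rewrite scaler_nat.
by case: (odd (i + j)); rewrite ?expr1 ?expr0 ?mul1r ?mulN1r ?coefN.
Qed.

Lemma newton_tfE n (e : 'I_n -> V) (b : {biscalar V}) k (kn : (k < n)%N) i j :
  orthonormal_basis g e ->
  bilin_of_dform (newton_tf g e b k kn) (e i) (e j) =
  (cofactor ('X%:M + map_mx polyC (bilin_mx e b)) i j)`_(n - 1 - k).
Proof. by case=> _ oe; apply: newton_tf_coef. Qed.

End OrthonormalHodge.

(** * Characteristic coefficients *)

Lemma char_coefE (R : realFieldType) n (V : vectType R) (e : 'I_n -> V)
    (b : V -> V -> R) k :
  char_coef e b k = (\det ('X%:M + map_mx polyC (bilin_mx e b)))`_(n - k).
Proof.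
rewrite /char_coef /bilin_char_poly; set B := map_mx polyC _.
(* Replacing X by -X multiplies the coefficient of X^i by (-1)^i, which cancels the sign in
   [char_coef]. *)
have -> : B - 'X%:M = map_mx (comp_poly (- 'X)) ('X%:M + B).
  apply/matrixP => i j; rewrite !mxE comp_polyD comp_polyC addrC.
  by case: (i == j); rewrite ?mulr1n ?mulr0n ?comp_polyX ?comp_poly0 ?oppr0.
rewrite det_map_mx; set p := \det _.
suff -> i : (p \Po (- 'X))`_i = (-1) ^+ i * p`_i.
  by rewrite mulrA -expr2 sqrr_sign mul1r.
rewrite comp_polyE coef_sum.
have signC l : (-1) ^+ l = ((-1) ^+ l)%:P :> {poly R} by rewrite rmorph_sign.
under eq_bigr => l _ do rewrite exprNn signC mul_polyC scalerA
  coefZ coefXn.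
have [ip|pi] := ltnP i (size p).
  rewrite (bigD1 (Ordinal ip)) //= eqxx mulr1 big1 ?addr0 1?mulrC // => l li.
  by rewrite eq_sym (negbTE (li : (_ != _ :> nat))) mulr0.
rewrite nth_default // mulr0 big1 // => l _.
by rewrite gtn_eqF ?mulr0 // (leq_trans (ltn_ord l)).
Qed.

Lemma bilin_detE (R : realFieldType) n (V : vectType R) (e : 'I_n -> V)
    (b : V -> V -> R) :
  bilin_det e b = char_coef e b n.
Proof.
rewrite char_coefE subnn -horner_coef0 -horner_evalE -det_map_mx.
congr (\det _).
by apply/matrixP => i j; rewrite !mxE /= /horner_eval hornerD hornerMn
  hornerX hornerC mul0rn add0r.
Qed.

(** * Time derivatives of polynomials and Jacobi's formula *)

Section CoefficientwiseDerivative.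
Variables (R : realType) (t : R).

Definition coef_derive (P : R -> {poly R}) (dP : {poly R}) : Prop :=
  forall k, is_derive t 1 (fun s => (P s)`_k) dP`_k.

Lemma is_derive_bigsum (I : Type) (r : seq I) (F : I -> R -> R) (dF : I -> R) :
  (forall i, is_derive t 1 (F i) (dF i)) ->
  is_derive t 1 (fun s => \sum_(i <- r) F i s) (\sum_(i <- r) dF i).
Proof.
move=> hF; elim: r => [|i r IHr].
  rewrite big_nil; under eq_fun do rewrite big_nil.
  exact: is_derive_cst.
rewrite big_cons; under eq_fun do rewrite big_cons.
exact: is_deriveD.
Qed.

Lemma coef_derive_sum (I : Type) (r : seq I) (P : I -> R -> {poly R}) dP :
  (forall i, coef_derive (P i) (dP i)) ->
  coef_derive (fun s => \sum_(i <- r) P i s) (\sum_(i <- r) dP i).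
Proof.
move=> hP k; rewrite coef_sum; under eq_fun do rewrite coef_sum.
by apply: is_derive_bigsum => i; apply: hP.
Qed.

Lemma coef_derive_cst p : coef_derive (fun=> p) 0.
Proof. by move=> k; rewrite coef0; apply: is_derive_cst. Qed.

Lemma coef_deriveM P Q dP dQ : coef_derive P dP -> coef_derive Q dQ ->
  coef_derive (fun s => P s * Q s) (dP * Q t + P t * dQ).
Proof.
move=> hP hQ k; rewrite coefD !coefM -big_split.
under eq_fun do rewrite coefM.
apply: is_derive_bigsum => i; apply: is_derive_eq.
  exact: (is_deriveM (hP i) (hQ (k - i)%N)).
by rewrite addrC /= [_ *: dP`_i]mulrC.
Qed.

Lemma coef_derive_prod (I : finType) (P : I -> R -> {poly R}) dP :
  (forall i, coef_derive (P i) (dP i)) ->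
  coef_derive (fun s => \prod_i P i s)
    (\sum_i \prod_j (if j == i then dP j else P j t)).
Proof.
move=> hP.
(* Without repetitions, the test [j == i] replaces exactly one factor by its derivative. *)
suff H (r : seq I) : uniq r -> coef_derive (fun s => \prod_(i <- r) P i s)
    (\sum_(i <- r) \prod_(j <- r) (if j == i then dP j else P j t)).
  exact: H (index_enum_uniq _).
elim: r => [_|i r IHr /= /andP [ir ur]].
  rewrite big_nil; under eq_fun do rewrite big_nil.
  exact: coef_derive_cst.
under eq_fun do rewrite big_cons.
rewrite big_cons.
have -> : \prod_(j <- i :: r) (if j == i then dP j else P j t) =
    dP i * \prod_(j <- r) P j t.
  rewrite big_cons eqxx; congr (_ * _); apply: eq_big_seq => j jr.
  by case: eqP jr ir => // -> ->.
rewrite (_ : \sum_(j <- r) _ = P i t *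
    \sum_(j <- r) \prod_(l <- r) (if l == j then dP l else P l t)).
  by apply: coef_deriveM => //; apply: IHr.
rewrite mulr_sumr; apply: eq_big_seq => j jr; rewrite big_cons.
by case: eqP jr ir => // -> ->.
Qed.

(** The product rule in the Leibniz formula gives a sum of determinants [N i] with row i
    differentiated. Expanding [N i] along that row produces the cofactors of [M t], which do not
    involve row i; no invertibility enters. *)
Lemma coef_derive_det n (M : R -> 'M[{poly R}]_n) (dM : 'M[{poly R}]_n) :
  (forall i j, coef_derive (fun s => M s i j) (dM i j)) ->
  coef_derive (fun s => \det (M s)) (\sum_i \sum_j dM i j * cofactor (M t) i j).
Proof.
move=> hM.
pose N i : 'M[{poly R}]_n :=
  \matrix_(k, j) (if k == i then dM k j else M t k j).
have -> : \sum_i \sum_j dM i j * cofactor (M t) i j = \sum_i \det (N i).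
  apply: eq_bigr => i _; rewrite (expand_det_row _ i); apply: eq_bigr => j _.
  rewrite mxE eqxx; congr (_ * (_ * \det _)).
  by apply/matrixP => k l; rewrite !mxE eq_sym (negbTE (neq_lift _ _)).
rewrite /determinant exchange_big /=.
apply: coef_derive_sum => s.
have := coef_deriveM _ _ _ _ (coef_derive_cst ((-1) ^+ s))
  (coef_derive_prod _ _ _ (fun i => hM i (s i))).
rewrite mul0r add0r mulr_sumr; congr (coef_derive _ _).
apply: eq_bigr => i _; congr (_ * _); apply: eq_bigr => j _.
by rewrite mxE.
Qed.

End CoefficientwiseDerivative.

Theorem proposition2p9 (R : realType) (n : nat) (V : vectType R)
    (g : {dot V for idfun}) (e : 'I_n -> V) (he : orthonormal_basis g e)
    (h : R -> {biscalar V}) (t : R)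
    (hdiff : forall x y : V, derivable (fun s : R => h s x y) t 1) :
  (forall (k : nat) (hk : (0 < k <= n)%N),
    is_derive t 1 (fun s : R => char_coef e (h s) k)
      (bilin_inner e
         (bilin_of_dform (newton_tf g e (h t) k.-1 (pred_ltn hk)))
         (fun x y => derive1 (fun s : R => h s x y) t)))
  /\
  (forall hn : (0 < n)%N,
    is_derive t 1 (fun s : R => bilin_det e (h s))
      (bilin_inner e
         (bilin_of_dform (newton_tf g e (h t) n.-1 (pred_ltnn hn)))
         (fun x y => derive1 (fun s : R => h s x y) t))).
Proof.
(* The bound [kn] is quantified separately so that both conclusions, which carry different proofs of
   it, are instances. *)
have main k (hk : (0 < k <= n)%N) (kn : (k.-1 < n)%N) :
    is_derive t 1 (fun s : R => char_coef e (h s) k)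
      (bilin_inner e (bilin_of_dform (newton_tf g e (h t) k.-1 kn))
         (fun x y => derive1 (fun s : R => h s x y) t)).
  under eq_fun do rewrite char_coefE.
  pose M s : 'M[{poly R}]_n := 'X%:M + map_mx polyC (bilin_mx e (h s)).
  pose dM : 'M[{poly R}]_n :=
    \matrix_(i, j) (derive1 (fun s : R => h s (e i) (e j)) t)%:P.
  have hM i j : coef_derive R t (fun s => M s i j) (dM i j).
    move=> l; rewrite mxE coefC; under eq_fun do rewrite !mxE coefD coefC.
    rewrite -[X in is_derive _ _ _ X]add0r.
    apply: (is_deriveD (is_derive_cst _ _ _)).
    (* Only the constant coefficient of an entry of X + h varies with time. *)
    case: eqP => _; last exact: is_derive_cst.
    by rewrite derive1E; apply: derivableP.
  apply: is_derive_eq; first exact: (coef_derive_det _ _ _ _ _ hM (n - k)%N).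
  rewrite coef_sum; apply: eq_bigr => i _.
  rewrite coef_sum; apply: eq_bigr => j _.
  rewrite newton_tfE // mxE coefCM mulrC; congr (_`_ _ * _).
  (* The indices agree because n - 1 - (k - 1) = n - k, which relies on k > 0. *)
  by case/andP: hk; lia.
split=> [k hk|hn]; first exact: main.
under eq_fun do rewrite bilin_detE.
by apply: main; rewrite hn leqnn.
Qed.
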